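(* Let $(K,L)$ be a $(\gamma_n,1/n)$-admissible pair and $p>1$. Then for all $\lambda\in(0,1)$, \[ \gamma_n\bigl((1-\lambda)\cdot K+_p\lambda\cdot L\bigr)^{p/n}\geqslant(1-\lambda)\gamma_n(K)^{p/n}+\lambda\gamma_n(L)^{p/n} \] whenever $(1-\lambda)\cdot K+_p\lambda\cdot L$ is measurable. If moreover $K,L$ are convex bodies, equality holds for some $\lambda\in(0,1)$ and $p>1$ if and only if $K=L$ and $0\in K\cap L$.
   Context: $\gamma_n$ is the standard Gaussian measure, $\mathrm{d}\gamma_n(x)=(2\pi)^{-n/2}e^{-\|x\|^2/2}\mathrm{d}x$. A pair $(K,L)$ of nonempty measurable sets with $\gamma_n(K)\gamma_n(L)>0$, such that every $\lambda_1K+\lambda_2L$ with $\lambda_1,\lambda_2\geqslant0$, $\lambda_1+\lambda_2\leqslant1$, is measurable, is $(\gamma_n,1/n)$-admissible if $\gamma_n((1-\lambda)K+\lambda L)^{1/n}\geqslant(1-\lambda)\gamma_n(K)^{1/n}+\lambda\gamma_n(L)^{1/n}$ for all $\lambda\in(0,1)$. Convex body: nonempty compact convex set. For $p>1$, $1/p+1/q=1$; $K+_pL=\{(1-\mu)^{1/q}x+\mu^{1/q}y: x\in K, y\in L, \mu\in[0,1]\}$, $\lambda\cdot K=\lambda^{1/p}K$. *)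

(* Defs.v *)
From HB Require Import structures.
From mathcomp Require Import all_boot all_order all_algebra.
From mathcomp Require Import all_classical all_reals all_analysis.
Set Implicit Arguments. Unset Strict Implicit. Unset Printing Implicit Defensive.
Import Order.TTheory GRing.Theory Num.Theory.
Import numFieldNormedType.Exports.
Local Open Scope classical_set_scope.
Local Open Scope ring_scope.

Section Gauss.
Variable R : realType.

Definition gdens (x : R) : R := (Num.sqrt (2 * pi))^-1 * expR (- (x ^+ 2) / 2).

Definition cons_row n (x : R) (t : 'rV[R]_n) : 'rV[R]_n.+1 :=
  \row_(i < n.+1) (if unlift ord0 i is Some j then t ord0 j else x).

(** gamma_n on Borel sets, written as an iterated (Fubini) integral of the
    density (2 pi)^(-n/2) e^(-|x|^2/2) = prod_i gdens x_i against Lebesgue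
    measure; for a Borel set A this is the integral of the Gaussian density
    over A. *)
Fixpoint gauss_borel (n : nat) : set 'rV[R]_n -> \bar R :=
  match n with
  | 0 => fun A => (\1_A (0 : 'rV[R]_0))%:E
  | m.+1 => fun A =>
      (\int[@lebesgue_measure R]_(x in [set: R])
          ((gdens x)%:E * gauss_borel [set t | A (cons_row x t)]))%E
  end.

Definition borel_set n (A : set 'rV[R]_n) : Prop :=
  <<s [set U : set 'rV[R]_n | open U] >> A.

(** gamma_n-measurable (= Lebesgue measurable) sets: those of the completion *)
Definition gmeasurable n (S : set 'rV[R]_n) : Prop :=
  exists A B : set 'rV[R]_n, [/\ borel_set A, borel_set B, A `<=` S, S `<=` B
                                & gauss_borel (B `\` A) = 0%E].

(** gamma_n(S) (outer measure; equals the completed Gaussian measure on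
    gamma_n-measurable sets), as a real number in [0,1] *)
Definition gamma n (S : set 'rV[R]_n) : R :=
  fine (ereal_inf [set gauss_borel B | B in [set B | borel_set B /\ S `<=` B]]).

Definition mink n (a : R) (K : set 'rV[R]_n) (b : R) (L : set 'rV[R]_n) :=
  [set a *: x + b *: y | x in K & y in L].

Definition admissible n (K L : set 'rV[R]_n) : Prop :=
  [/\ K !=set0 /\ L !=set0, gmeasurable K /\ gmeasurable L,
      0 < gamma K * gamma L,
      (forall l1 l2 : R, 0 <= l1 -> 0 <= l2 -> l1 + l2 <= 1 ->
         gmeasurable (mink l1 K l2 L)) &
      (forall l : R, 0 < l < 1 ->
         gamma (mink (1 - l) K l L) `^ (n%:R^-1) >=
         (1 - l) * gamma K `^ (n%:R^-1) + l * gamma L `^ (n%:R^-1))].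

Definition pscale n (p l : R) (K : set 'rV[R]_n) : set 'rV[R]_n :=
  [set (l `^ (p^-1)) *: x | x in K].

(** L_p sum K +_p L, with 1/q = 1 - 1/p *)
Definition psum n (p : R) (K L : set 'rV[R]_n) : set 'rV[R]_n :=
  [set z | exists x, exists y, exists mu : R,
     [/\ K x, L y, 0 <= mu <= 1 &
         z = ((1 - mu) `^ (1 - p^-1)) *: x + (mu `^ (1 - p^-1)) *: y]].

Definition convex_body n (K : set 'rV[R]_n) : Prop :=
  [/\ K !=set0, compact K & convex_set (K : set (convex_lmodType 'rV[R]_n))].

End Gauss.

(* Main.v *)
Require Import Defs.
From HB Require Import structures.
From mathcomp Require Import all_boot all_order all_algebra.
From mathcomp Require Import all_classical all_reals all_analysis.
From mathcomp Require Import measurable_realfun ring lra.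
Import Order.TTheory GRing.Theory Num.Theory.
Import numFieldNormedType.Exports.
Set Implicit Arguments. Unset Strict Implicit. Unset Printing Implicit Defensive.
Local Open Scope classical_set_scope.
Local Open Scope ring_scope.

(** Every fibre [a K + b L] of the L_p sum, [a = (1-mu)^(1/q) (1-l)^(1/p)] and
    [b = mu^(1/q) l^(1/p)], equals [s ((1-t) K + t L)] with [s = a + b <= 1].
    Since the Gaussian density decreases along rays, [gamma (s A) >= s^n gamma A]
    for [s <= 1]; together with admissibility this bounds the measure of the
    fibre, and Hölder's inequality selects the best [mu].

    In the equality case [s = 1], for otherwise the dilation inequality is strict.
    Hence [mu = l] and [(1-l) K + l L] has full measure in the L_p sum; being
    compact it is the whole L_p sum, because a point outside it would come with a
    small homothetic copy of [K] or [L], which has positive measure. For support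
    functions this says that [a h_K + b h_L] is maximal at [mu = l]; the vanishing
    derivative gives [h_K = h_L], and [mu = 0] gives [h_K >= 0]. *)

(** * Borel sets of row vectors *)

(** A measurable space whose measurable sets are by definition those of [borel_set], so that general
    measure theory applies to them. *)
Definition borelT (R : realType) (n : nat) :=
  g_sigma_algebraType [set U : set 'rV[R]_n | open U].

Section borel.
Variable R : realType.

Lemma open_borel n (U : set 'rV[R]_n) : open U -> borel_set U.
Proof. by move=> oU; exact: sub_sigma_algebra. Qed.

Lemma borel_setC n (A : set 'rV[R]_n) : borel_set A -> borel_set (~` A).
Proof. exact: (@measurableC _ (borelT R n)). Qed.

Lemma closed_borel n (A : set 'rV[R]_n) : closed A -> borel_set A.
Proof.
by move=> /closed_openC /open_borel /borel_setC; rewrite setCK.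
Qed.

Lemma borel_setD n (A B : set 'rV[R]_n) :
  borel_set A -> borel_set B -> borel_set (A `\` B).
Proof. exact: (@measurableD _ (borelT R n)). Qed.

Lemma borel_preimage m n (f : 'rV[R]_m -> 'rV[R]_n) (A : set 'rV[R]_n) :
  continuous f -> borel_set A -> borel_set (f @^-1` A).
Proof.
move=> /continuousP cf mA; rewrite -[_ @^-1` _]setTI.
suff : @measurable_fun _ _ (borelT R m) (borelT R n) setT f by apply.
apply: (@measurability _ _ (borelT R m) (borelT R n) setT f
  [set U : set 'rV[R]_n | open U]) => //.
move=> _ [U oU <-]; rewrite setTI; apply: (@open_borel m); exact: cf.
Qed.

Lemma continuous_affine n (c : R) (v : 'rV[R]_n) :
  continuous (fun z : 'rV[R]_n => c *: z + v).
Proof.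
move=> z; apply: (@continuousD _ _ _ (fun z => c *: z) (cst v)).
  exact: scaler_continuous.
exact: cst_continuous.
Qed.

(** Balls of row vectors are taken entrywise, hence are boxes and factor into a first coordinate and
    the rest. *)
Lemma ball_cons_row n (q : 'rV[R]_n.+1) r x (t : 'rV[R]_n) :
  ball q r (cons_row x t) <->
  ball (q ord0 ord0) r x /\ ball (\row_j q ord0 (lift ord0 j)) r t.
Proof.
split=> [[r0 qxt]|[qx [r0 qt]]].
  split; first by have := qxt ord0 ord0; rewrite mxE unlift_none.
  split=> // i j; rewrite mxE (ord1 i).
  by have := qxt ord0 (lift ord0 j); rewrite mxE liftK.
split=> // i j; rewrite !ord1 mxE; case: unliftP => [k ->|->] //.
by have := qt ord0 k; rewrite mxE.
Qed.

Lemma continuous_cons_row n (x : R) : continuous (@cons_row R n x).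
Proof.
move=> t U /nbhs_ballP[e e0 eU]; apply/nbhs_ballP; exists e => // s ts.
apply: eU; apply/ball_cons_row; rewrite mxE unlift_none.
split; first exact: ballxx.
by rewrite (_ : \row_j _ = t)//; apply/rowP => j; rewrite !mxE liftK.
Qed.

Lemma borel_slice n x (A : set 'rV[R]_n.+1) :
  borel_set A -> borel_set [set t | A (cons_row x t)].
Proof. by apply: borel_preimage; exact: continuous_cons_row. Qed.

(** A base of the topology indexed by a countable type. *)
Definition rat_ball n (p : 'rV[rat]_n * nat) : set 'rV[R]_n :=
  ball (map_mx ratr p.1 : 'rV[R]_n) p.2.+1%:R^-1.

Lemma open_bigcup_rat_ball n (U : set 'rV[R]_n) : open U ->
  U = \bigcup_(p in [set p | rat_ball p `<=` U]) rat_ball p.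
Proof.
move=> oU; apply/seteqP; split=> [z Uz|z [p /= pU]]; last exact: pU.
have /nbhs_ballP[e /= e0 zeU] := open_nbhs_nbhs (conj oU Uz).
(* The centre of the rational ball is within one radius of [z], so a radius below [e / 2] keeps the
   whole ball within [e] of [z]. *)
have [k ke] : exists k, k.+1%:R^-1 < e / 2 :> R.
  have e20 : 0 < e / 2 by rewrite divr_gt0.
  have [k _ /(_ k (leqnn _))] := near_infty_natSinv_lt (PosNum e20).
  by exists k.
have k0 : 0 < k.+1%:R^-1 :> R by rewrite invr_gt0.
have ex i : exists q : rat, `|z ord0 i - ratr q| < k.+1%:R^-1.
  have /rat_in_itvoo[q] : z ord0 i - k.+1%:R^-1 < z ord0 i + k.+1%:R^-1.
    by rewrite ltrD2l; apply: lt_trans k0; rewrite oppr_lt0.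
  by rewrite in_itv/= => /andP[q1 q2]; exists q; rewrite distrC ltr_distl q1 q2.
have [q qP] := choice ex.
pose Q := \row_i q i.
have Qz : ball (map_mx ratr Q : 'rV[R]_n) k.+1%:R^-1 z.
  by split=> // i j; rewrite /ball /= !mxE (ord1 i) distrC; exact: qP.
exists (Q, k) => //= w Qw; apply: zeU.
apply: (@le_ball _ _ _ (k.+1%:R^-1 + k.+1%:R^-1)); first by rewrite [leRHS]splitr lerD// ltW.
by apply: ball_triangle Qw; exact: ball_sym.
Qed.

(** An open set is a countable union of rational boxes, and the preimage of a box is a measurable
    rectangle. This connects the product sigma-algebra, needed for Fubini sections, with the Borel
    sets one dimension higher. *)
Lemma measurable_cons_row n :
  @measurable_fun _ _ (measurableTypeR R * borelT R n)%type (borelT R n.+1) setT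
    (fun p => cons_row p.1 p.2).
Proof.
apply: (@measurability _ _ _ (borelT R n.+1) _ _ [set U : set 'rV[R]_n.+1 | open U]) => //.
move=> _ [U oU <-]; rewrite setTI (open_bigcup_rat_ball oU) preimage_bigcup.
rewrite bigcup_mkcond; apply: countable_bigcupT_measurable => //= p.
case: ifPn => // _.
rewrite (_ : _ @^-1` _ =
  ball ((map_mx ratr p.1 : 'rV[R]_n.+1) ord0 ord0) p.2.+1%:R^-1 `*`
  ball (\row_j (map_mx ratr p.1 : 'rV[R]_n.+1) ord0 (lift ord0 j))
     p.2.+1%:R^-1).
  apply: measurableX; first by apply: measurable_realfun.open_measurable; exact: ball_open.
  by apply: open_borel; exact: ball_open.
by apply/seteqP; split=> [[x t]|[x t]] /ball_cons_row.
Qed.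

End borel.

(** * The Gaussian measure *)

Section slice.
Variable R : realType.
Local Notation leb := (@lebesgue_measure R).

Lemma gdensE (x : R) : gdens x = normal_pdf 0 1 x.
Proof.
rewrite normal_pdfE ?oner_neq0// /gdens /normal_peak /normal_fun subr0 expr1n.
by rewrite mul1r mulr_natl.
Qed.

Lemma gdens_gt0 (x : R) : 0 < gdens x.
Proof. by rewrite mulr_gt0 ?expR_gt0// invr_gt0 sqrtr_gt0 mulr_gt0 ?pi_gt0. Qed.

Lemma measurable_gdens : measurable_fun [set: R] (@gdens R).
Proof.
by rewrite (_ : @gdens R = normal_pdf 0 1); [exact: measurable_normal_pdf|
  exact/funext/gdensE].
Qed.

Lemma emeasurable_gdens : measurable_fun [set: R] (fun x : R => (gdens x)%:E).
Proof. by apply: measurableT_comp => //; exact: measurable_gdens. Qed.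

Lemma integral_gdens : (\int[leb]_x (gdens x)%:E = 1)%E.
Proof.
by rewrite -(@integral_normal_pdf R 0 1); apply: eq_integral => x _; rewrite gdensE.
Qed.

Variable n : nat.
Variable P : probability (borelT R n) R.
Local Open Scope ereal_scope.

(** The slice at [x] is the [x]-section of the preimage of [A] in the product space. *)
Lemma measurable_slice (A : set (borelT R n.+1)) : measurable A ->
  measurable_fun [set: R] (fun x : R => P [set t | A (cons_row x t)]).
Proof.
move=> mA.
have mA' : measurable ((fun p : measurableTypeR R * borelT R n =>
    cons_row p.1 p.2 : borelT R n.+1) @^-1` A).
  by rewrite -[_ @^-1` _]setTI; exact: measurable_cons_row.
have := measurable_fun_xsection P mA'.
apply: eq_measurable_fun => x _ /=; congr (P _).
by apply/seteqP; split=> t; rewrite /xsection/= inE.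
Qed.

(** One recursion step of [gauss_borel] with a genuine probability inside, so that it can be proved
    to be a probability again. *)
Definition slice_measure (A : set (borelT R n.+1)) : \bar R :=
  \int[leb]_x ((gdens x)%:E * P [set t | A (cons_row x t)]).

Let slice0 : slice_measure set0 = 0.
Proof. by apply: integral0_eq => x _; rewrite [P _](@measure0 _ _ _ P) mule0. Qed.

Let slice_ge0 A : 0 <= slice_measure A.
Proof.
by apply: integral_ge0 => x _; rewrite mule_ge0// lee_fin ltW// gdens_gt0.
Qed.

Let slice_sigma_additive : semi_sigma_additive slice_measure.
Proof.
move=> F mF tF mUF.
rewrite [X in _ --> X](_ : _ = \sum_(k <oo) slice_measure (F k)).
  by apply/cvg_closeP; split; [exact: is_cvg_nneseries|rewrite closeE].
rewrite -integral_nneseries//; first last.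
- by move=> k x _; rewrite mule_ge0// lee_fin ltW// gdens_gt0.
- move=> k; apply: emeasurable_funM; last exact: measurable_slice.
  exact: emeasurable_gdens.
apply: eq_integral => x _; rewrite nneseriesZl//; last first.
congr (_ * _); apply/esym/cvg_lim => //.
rewrite (_ : [set t | _] = \bigcup_k [set t | F k (cons_row x t)])//.
apply: (@measure_semi_sigma_additive _ _ _ P) => //.
- by move=> k; exact: (borel_slice x (mF k)).
- apply/trivIsetP => i j _ _ ij; move/trivIsetP : tF => /(_ i j I I ij).
  by rewrite -!subset0 => FF t [Fi Fj]; exact: (FF (cons_row x t)).
- exact: (borel_slice x mUF).
Qed.

HB.instance Definition _ := isMeasure.Build _ _ _ slice_measure
  slice0 slice_ge0 slice_sigma_additive.

Let slice_setT : slice_measure setT = 1.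
Proof.
rewrite -integral_gdens; apply: eq_integral => x _.
by rewrite [P _](@probability_setT _ _ _ P) mule1.
Qed.

HB.instance Definition _ := @Measure_isProbability.Build _ _ R slice_measure slice_setT.

End slice.

Section gauss.
Variable R : realType.
Local Notation leb := (@lebesgue_measure R).

(** [gauss_borel] is only a function on sets; monotonicity, additivity and bounds on Borel sets are
    all transferred from this [P]. *)
Lemma gauss_probability n : exists P : probability (borelT R n) R,
  forall A : set (borelT R n), measurable A -> P A = gauss_borel A.
Proof.
elim: n => [|n [P PE]]; first by exists (dirac (0 : borelT R 0)).
exists (slice_measure P) => A mA /=; apply: eq_integral => x _.
by rewrite PE//; exact: (borel_slice x mA).
Qed.

Lemma gauss_borel_ge0 n (A : set 'rV[R]_n) : borel_set A -> (0 <= gauss_borel A)%E.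
Proof. by move=> mA; have [P <-] := gauss_probability n. Qed.

Lemma gauss_borel_le1 n (A : set 'rV[R]_n) : borel_set A -> (gauss_borel A <= 1)%E.
Proof. by move=> mA; have [P <-//] := gauss_probability n; exact: probability_le1. Qed.

Lemma le_gauss_borel n (A B : set 'rV[R]_n) : borel_set A -> borel_set B ->
  A `<=` B -> (gauss_borel A <= gauss_borel B)%E.
Proof.
move=> mA mB AB; have [P PE] := gauss_probability n.
by rewrite -!PE// le_measure// inE.
Qed.

Lemma gauss_borelD n (A B : set 'rV[R]_n) : borel_set A -> borel_set B ->
  A `<=` B -> (gauss_borel B = gauss_borel A + gauss_borel (B `\` A))%E.
Proof.
move=> mA mB AB; have [P PE] := gauss_probability n.
have mD : borel_set (B `\` A) by exact: borel_setD.
rewrite -!PE// -measureU//; first by rewrite setDUK.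
by rewrite setDIK.
Qed.

Lemma measurable_gauss_slice n (A : set 'rV[R]_n.+1) : borel_set A ->
  measurable_fun [set: R] (fun x : R => gauss_borel [set t | A (cons_row x t)]).
Proof.
move=> mA; have [P PE] := gauss_probability n.
apply: (eq_measurable_fun _ _ (measurable_slice P mA)) => x _.
by rewrite PE//; exact: (borel_slice x mA).
Qed.

(** Lebesgue measure equals [c] times its push-forward under [c * x + v]: the two agree on half-open
    intervals, which determine the measure. *)
Lemma ge0_integral_affine (c v : R) (f : R -> \bar R) : 0 < c ->
  measurable_fun [set: R] f -> (forall x, 0 <= f x)%E ->
  (\int[leb]_x f x = c%:E * \int[leb]_x f (c * x + v)%R)%E.
Proof.
move=> c0 mf f0.
pose g : measurableTypeR R -> measurableTypeR R := fun x => c * x + v.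
have mg : measurable_fun setT g.
  by apply: measurable_funD => //; exact: measurable_funM.
pose k : {nonneg R} := NngNum (ltW c0).
pose nu := measure_function_pushforward__canonical__measure_function_Measure leb mg.
pose mu := mscale k nu.
have lebE A : measurable A -> leb A = mu A.
  apply: lebesgue_measure_unique => _ [[a b] _ <-] /=.
  rewrite /mu /mscale /=.
  have -> : pushforward leb g `]a, b] = leb `](a - v) / c, (b - v) / c]%classic.
    congr leb; apply/seteqP; split=> x /=; rewrite !in_itv/= /g ltr_pdivrMr// ler_pdivlMr//
      ltrBlDr lerBrDr [x * c]mulrC//.
  rewrite !lebesgue_measure_itv/= !lte_fin ltr_pM2r ?invr_gt0// ltrD2r.
  case: ifP => _; last by rewrite mule0.
  rewrite -!EFinD -EFinM; congr EFin; field; exact: lt0r_neq0.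
rewrite (eq_measure_integral mu); last by move=> A mA _; exact: lebE.
rewrite ge0_integral_mscale//= ge0_integral_pushforward//.
Qed.

End gauss.

(** * Dilations and translations *)

Section dilation.
Variable R : realType.
Local Notation leb := (@lebesgue_measure R).

Lemma ge0_integral_eq0P (f : R -> \bar R) :
  measurable_fun [set: R] f -> (forall x, 0 <= f x)%E ->
  (\int[leb]_x f x = 0)%E <->
  exists N : set (measurableTypeR R),
    [/\ measurable N, leb N = 0 & forall x, f x != 0%E -> N x].
Proof.
move=> mf f0.
have -> : (\int[leb]_x f x = \int[leb]_x `|f x|)%E.
  by apply: eq_integral => x _; rewrite gee0_abs.
apply: (iff_trans (ae_eq_integral_abs leb measurableT mf)).
split=> -[N [mN N0 fN]]; exists N; split=> //.
  by move=> x fx; apply: fN => /= /(_ I) fx0; rewrite fx0 eqxx in fx.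
by move=> x /= fx; apply: fN; apply/eqP => fx0; apply: fx => _.
Qed.

Lemma lebesgue_affine_null (c v : R) (N : set (measurableTypeR R)) : 0 < c ->
  measurable N -> leb N = 0%E ->
  let M := [set x : measurableTypeR R | N (c * x + v)] in
  measurable M /\ leb M = 0%E.
Proof.
move=> c0 mN N0 M.
have mM : measurable M.
  rewrite -[M]setTI; suff : @measurable_fun _ _ (measurableTypeR R)
    (measurableTypeR R) setT (fun x => c * x + v) by apply.
  by apply: measurable_funD => //; exact: measurable_funM.
split=> //.
have mi (A : set (measurableTypeR R)) : measurable A ->
    measurable_fun [set: R] (fun x : R => (\1_A x)%:E : \bar R).
  by move=> mA; apply/measurable_EFinP; exact: measurable_indic.
have i0 x : (0 <= (\1_N x)%:E :> \bar R)%E by rewrite lee_fin.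
have := ge0_integral_affine v c0 (mi _ mN) i0.
have -> : (\int[leb]_x (\1_N x)%:E = 0)%E by rewrite integral_indic// setIT.
rewrite (_ : (\int[leb]_x (\1_N (c * x + v))%:E)%E = leb M); last first.
  by rewrite -[in RHS](setIT M) -integral_indic.
by move=> /esym/eqP; rewrite mule_eq0 eqe gt_eqF//= => /eqP.
Qed.

Lemma affine_cons_row n (c x : R) (t : 'rV[R]_n) (v : 'rV[R]_n.+1) :
  c *: cons_row x t + v =
  cons_row (c * x + v ord0 ord0) (c *: t + \row_j v ord0 (lift ord0 j)).
Proof.
apply/rowP => i; rewrite !mxE; by case: unliftP => [j ->|->]; rewrite ?mxE.
Qed.

Lemma scale_cons_row n (c x : R) (t : 'rV[R]_n) :
  c *: cons_row x t = cons_row (c * x) (c *: t).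
Proof. by apply/rowP => i; rewrite !mxE; case: unliftP => [j _|_]; rewrite ?mxE. Qed.

Lemma borel_affine n c (v : 'rV[R]_n) (A : set 'rV[R]_n) :
  borel_set A -> borel_set [set z | A (c *: z + v)].
Proof. by apply: borel_preimage; exact: continuous_affine. Qed.

Lemma borel_scale n c (A : set 'rV[R]_n) :
  borel_set A -> borel_set [set z | A (c *: z)].
Proof. by apply: borel_preimage; exact: scaler_continuous. Qed.

Lemma gauss_slice_ge0 n (A : set 'rV[R]_n.+1) x : borel_set A ->
  (0 <= gauss_borel [set t | A (cons_row x t)])%E.
Proof. by move=> mA; apply: gauss_borel_ge0; exact: borel_slice. Qed.

Lemma measurable_gdens_slice n (A : set 'rV[R]_n.+1) : borel_set A ->
  measurable_fun [set: R] (fun x : R =>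
    (gdens x)%:E * gauss_borel [set t | A (cons_row x t)])%E.
Proof.
move=> mA; apply: emeasurable_funM; first exact: emeasurable_gdens.
exact: measurable_gauss_slice.
Qed.

(** As the density is positive, a set is null exactly when almost every slice is. The slice of the
    preimage at [x] is an affine preimage of the slice of [A] at [c * x + v ord0 ord0], and Lebesgue
    null sets of such [x] are preserved. *)
Lemma gauss_borel_affine_null n c (v : 'rV[R]_n) (A : set 'rV[R]_n) : 0 < c ->
  borel_set A -> gauss_borel A = 0%E ->
  gauss_borel [set z | A (c *: z + v)] = 0%E.
Proof.
move=> c0; elim: n v A => [|n IH] v A mA.
  rewrite (_ : [set z | _] = A)//.
  by apply/seteqP; split=> z /=; rewrite (thinmx0 (c *: z + v)) (thinmx0 z).
have d0 (B : set 'rV[R]_n.+1) x : borel_set B ->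
    (0 <= (gdens x)%:E * gauss_borel [set t | B (cons_row x t)])%E.
  by move=> mB; rewrite mule_ge0 ?gauss_slice_ge0// lee_fin ltW// gdens_gt0.
move=> /=; rewrite ge0_integral_eq0P; [|exact: measurable_gdens_slice|by move=> x; exact: d0].
move=> [N [mN N0 NE]].
have mA' := borel_affine c v mA.
apply/(ge0_integral_eq0P (measurable_gdens_slice mA') (fun x => d0 _ x mA')).
have [mM M0] := lebesgue_affine_null (v ord0 ord0) c0 mN N0.
exists [set x | N (c * x + v ord0 ord0)]; split=> // x /= H.
apply: NE; apply: contra_neq H => /eqP.
rewrite mule_eq0 eqe gt_eqF ?gdens_gt0//= => /eqP H.
rewrite (_ : [set t | _] =
  [set t | [set t | A (cons_row (c * x + v ord0 ord0) t)]
     (c *: t + \row_j v ord0 (lift ord0 j))]); last first.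
  by apply/seteqP; split=> t /=; rewrite affine_cons_row.
by rewrite IH ?mule0//; exact: borel_slice.
Qed.

Lemma measurable_gdens_scale (s : R) :
  measurable_fun [set: R] (fun x : R => (gdens (s * x))%:E).
Proof.
apply: measurableT_comp => //; apply: measurableT_comp; first exact: measurable_gdens.
exact: measurable_funM.
Qed.

Lemma gdens_scale_ge (s x : R) : 0 < s <= 1 -> gdens x <= gdens (s * x).
Proof.
move=> /andP[s0 s1]; rewrite ler_wpM2l ?invr_ge0 ?sqrtr_ge0//.
rewrite ler_expR !mulNr lerN2 ler_wpM2r ?invr_ge0// exprMn ler_piMl ?sqr_ge0//.
by rewrite expr_le1// ltW.
Qed.

Lemma gdens_scale_gt (s x : R) : 0 < s < 1 -> x != 0 -> gdens x < gdens (s * x).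
Proof.
move=> /andP[s0 s1] x0.
rewrite ltr_pM2l ?invr_gt0 ?sqrtr_gt0 ?mulr_gt0 ?pi_gt0//.
rewrite ltr_expR !mulNr ltrN2 ltr_pM2r ?invr_gt0// exprMn.
by rewrite gtr_pMl ?exprn_even_gt0// expr_lt1// ltW.
Qed.

(** The substitution in the first coordinate yields one factor [s], the slices the other [n]. The
    density stays at [s * x] instead of being bounded, so that both the weak and the strict
    inequality can start from here. *)
Lemma gauss_dilation_step n (s : R) (A : set 'rV[R]_n.+1) : 0 < s -> borel_set A ->
  (forall B : set 'rV[R]_n, borel_set B ->
     (s ^+ n)%:E * gauss_borel B <= gauss_borel [set z | B (s^-1 *: z)])%E ->
  ((s ^+ n.+1)%:E *
     \int[leb]_x ((gdens (s * x))%:E * gauss_borel [set t | A (cons_row x t)])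
   <= gauss_borel [set z | A (s^-1 *: z)])%E.
Proof.
move=> s0 mA IH.
have mA' := borel_scale s^-1 mA.
have g0 (B : set 'rV[R]_n.+1) x y : borel_set B ->
    (0 <= (gdens x)%:E * gauss_borel [set t | B (cons_row y t)])%E.
  by move=> mB; rewrite mule_ge0 ?gauss_slice_ge0// lee_fin ltW// gdens_gt0.
have ms : measurable_fun [set: R] (fun x : R =>
    (gdens (s * x))%:E * gauss_borel [set t | A (cons_row x t)])%E.
  apply: emeasurable_funM; first exact: measurable_gdens_scale.
  exact: measurable_gauss_slice.
rewrite /= [leRHS](@ge0_integral_affine _ s 0)//; first last.
- by move=> x; exact: (g0 _ x x mA').
- exact: (measurable_gdens_slice mA').
rewrite exprS EFinM -muleA lee_pmul2l ?lte_fin//.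
rewrite -ge0_integralZl//; last 2 first.
- by move=> x _; exact: g0.
- by rewrite lee_fin exprn_ge0// ltW.
apply: ge0_le_integral => //.
- by move=> x _; rewrite mule_ge0 ?g0// lee_fin exprn_ge0// ltW.
- exact: measurable_funeM.
- apply: (measurableT_comp (measurable_gdens_slice mA')) => //.
  by apply: measurable_funD => //; exact: measurable_funM.
move=> x _; rewrite addr0 muleCA lee_pmul2l ?lte_fin ?gdens_gt0//.
apply: le_trans (IH _ (borel_slice x mA)) _.
rewrite le_eqVlt; apply/orP; left; apply/eqP; congr gauss_borel.
by apply/seteqP; split=> t /=; rewrite scale_cons_row mulKf// gt_eqF.
Qed.

Lemma gauss_borel_dilation n (s : R) (A : set 'rV[R]_n) : 0 < s <= 1 -> borel_set A ->
  ((s ^+ n)%:E * gauss_borel A <= gauss_borel [set z | A (s^-1 *: z)])%E.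
Proof.
move=> s01; have /andP[s0 s1] := s01.
elim: n A => [|n IH] A mA.
  rewrite expr0 mul1e (_ : [set z | _] = A)//.
  by apply/seteqP; split=> z /=; rewrite (thinmx0 (s^-1 *: z)) (thinmx0 z).
apply: le_trans (gauss_dilation_step s0 mA IH).
rewrite lee_pmul2l ?lte_fin ?exprn_gt0//=.
apply: ge0_le_integral => //.
- by move=> x _; rewrite mule_ge0 ?gauss_slice_ge0// lee_fin ltW// gdens_gt0.
- exact: measurable_gdens_slice.
- apply: emeasurable_funM; first exact: measurable_gdens_scale.
  exact: measurable_gauss_slice.
by move=> x _; rewrite lee_wpmul2r ?gauss_slice_ge0// lee_fin gdens_scale_ge.
Qed.

(** The hypothesis makes the integral of [gdens (s * x) - gdens x] against the slice measures
    vanish; this difference is positive for [x != 0], so almost every slice is null. *)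
Lemma gauss_borel_dilation_eq n (s : R) (A : set 'rV[R]_n.+1) : 0 < s < 1 ->
  borel_set A ->
  (gauss_borel [set z | A (s^-1 *: z)] <= (s ^+ n.+1)%:E * gauss_borel A)%E ->
  gauss_borel A = 0%E.
Proof.
move=> s01 mA; have /andP[s0 s1] := s01.
have s01' : 0 < s <= 1 by rewrite s0 ltW.
move=> H0; have := le_trans (gauss_dilation_step s0 mA
  (fun B => @gauss_borel_dilation n s B s01')) H0; rewrite lee_pmul2l ?lte_fin ?exprn_gt0// => H.
have h0 x := gauss_slice_ge0 x mA.
have D0 x : (0 <= (gdens (s * x) - gdens x)%:E :> \bar R)%E.
  by rewrite lee_fin subr_ge0 gdens_scale_ge.
have mD : measurable_fun [set: R] (fun x : R => (gdens (s * x) - gdens x)%:E *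
    gauss_borel [set t | A (cons_row x t)])%E.
  apply: emeasurable_funM; last exact: measurable_gauss_slice.
  apply: measurableT_comp => //; apply: measurable_funB; last exact: measurable_gdens.
  by apply: measurableT_comp; [exact: measurable_gdens|exact: measurable_funM].
have split : (\int[leb]_x ((gdens (s * x))%:E * gauss_borel [set t | A (cons_row x t)]) =
    gauss_borel A + \int[leb]_x ((gdens (s * x) - gdens x)%:E *
      gauss_borel [set t | A (cons_row x t)]))%E.
  rewrite /= -ge0_integralD//.
  - apply: eq_integral => x _; rewrite -ge0_muleDl//.
      by rewrite -EFinD addrC subrK.
    by rewrite lee_fin ltW// gdens_gt0.
  - by move=> x _; rewrite mule_ge0// lee_fin ltW// gdens_gt0.
  - exact: measurable_gdens_slice.
  - by move=> x _; exact: mule_ge0.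
(* Finiteness allows [gauss_borel A] to be cancelled in the extended reals. *)
have fA : gauss_borel A \is a fin_num.
  by rewrite ge0_fin_numE ?gauss_borel_ge0// (le_lt_trans (gauss_borel_le1 mA)) ?ltry.
have : (\int[leb]_x ((gdens (s * x) - gdens x)%:E *
      gauss_borel [set t | A (cons_row x t)]) = 0)%E.
  apply/eqP; rewrite eq_le integral_ge0 ?andbT; last by move=> x _; exact: mule_ge0.
  by move: H; rewrite split -[leRHS]adde0 leeD2lE.
rewrite ge0_integral_eq0P//; last by move=> x; exact: mule_ge0.
move=> [N [mN N0 NE]].
apply/(ge0_integral_eq0P (measurable_gdens_slice mA)).
  by move=> x; rewrite mule_ge0// lee_fin ltW// gdens_gt0.
(* At [x = 0] the two densities agree, so this point joins the exceptional set. *)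
exists (N `|` [set 0]); split; first exact: measurableU.
  by rewrite measureU0//; exact: lebesgue_measure_set1.
move=> x Hx; have [->|x0] := eqVneq x 0; first by right.
left; apply: NE; apply: contra_neq Hx => /eqP.
rewrite mule_eq0 eqe subr_eq0 gt_eqF ?gdens_scale_gt//= => /eqP ->.
by rewrite mule0.
Qed.

End dilation.

(** * The outer Gaussian measure of arbitrary sets *)

Section gamma.
Variable R : realType.
Variable n : nat.
Implicit Types S A B : set 'rV[R]_n.

Lemma borel_setT : borel_set [set: 'rV[R]_n].
Proof. by apply: open_borel; exact: openT. Qed.

(** The infimum lies between 0 and 1, so [fine] loses nothing. *)
Lemma gammaE S : (gamma S)%:E =
  ereal_inf [set gauss_borel B | B in [set B | borel_set B /\ S `<=` B]].
Proof.
rewrite /gamma fineK// ge0_fin_numE; last first.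
  by apply: le_ereal_inf_tmp => _ [B [mB _] <-]; exact: gauss_borel_ge0.
apply: (@le_lt_trans _ _ 1%E); last exact: ltry.
apply: ereal_inf_le; exists (gauss_borel [set: 'rV[R]_n]).
  by exists setT => //; split=> //; exact: borel_setT.
by apply: gauss_borel_le1; exact: borel_setT.
Qed.

Lemma gamma_le_borel S B : borel_set B -> S `<=` B -> ((gamma S)%:E <= gauss_borel B)%E.
Proof. by move=> mB SB; rewrite gammaE; apply: ereal_inf_lbound; exists B. Qed.

Lemma gamma_ge r S :
  (forall B, borel_set B -> S `<=` B -> (r%:E <= gauss_borel B)%E) -> r <= gamma S.
Proof.
move=> H; rewrite -lee_fin gammaE; apply: le_ereal_inf_tmp => _ [B [mB SB] <-].
exact: H.
Qed.

Lemma gamma_borel B : borel_set B -> (gamma B)%:E = gauss_borel B.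
Proof.
move=> mB; apply/eqP; rewrite eq_le gamma_le_borel//= gammaE.
by apply: le_ereal_inf_tmp => _ [C [mC BC] <-]; exact: le_gauss_borel.
Qed.

Lemma gamma_ge0 S : 0 <= gamma S.
Proof. by apply: gamma_ge => B mB _; exact: gauss_borel_ge0. Qed.

Lemma le_gamma S A : S `<=` A -> gamma S <= gamma A.
Proof.
move=> SA; apply: gamma_ge => B mB AB; apply: gamma_le_borel => //.
exact: subset_trans AB.
Qed.

Lemma gamma_setD_eq0 A B : borel_set A -> borel_set B -> A `<=` B ->
  gamma A = gamma B -> gauss_borel (B `\` A) = 0%E.
Proof.
move=> mA mB AB AE; have := gauss_borelD mA mB AB.
rewrite -(gamma_borel mA) -(gamma_borel mB) -(gamma_borel (borel_setD mB mA)).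
by rewrite AE => -[] /eqP; rewrite addrC -subr_eq subrr => /eqP <-.
Qed.

(** A Borel cover of the dilate pulls back to a Borel cover of [S], to which the Borel case
    applies. *)
Lemma gamma_dilation (s : R) S : 0 < s <= 1 ->
  s ^+ n * gamma S <= gamma [set s *: x | x in S].
Proof.
move=> s01; have /andP[s0 s1] := s01; apply: gamma_ge => B mB SB.
have mB' := borel_scale s mB.
have SB' : S `<=` [set z | B (s *: z)] by move=> x Sx /=; apply: SB; exists x.
rewrite EFinM; apply: (@le_trans _ _ ((s ^+ n)%:E * gauss_borel [set z | B (s *: z)])%E).
  by rewrite lee_pmul2l ?lte_fin ?exprn_gt0// gamma_le_borel.
apply: le_trans (gauss_borel_dilation s01 mB') _.
rewrite (_ : [set z | _] = B)//.
by apply/seteqP; split=> z; rewrite /mkset scalerA divff ?gt_eqF// scale1r.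
Qed.

End gamma.

(** Dimension 0 is excluded because dilations are the identity there. *)
Lemma gamma_dilation_eq (R : realType) n (s : R) (A : set 'rV[R]_n) :
  (0 < n)%N -> 0 < s < 1 -> borel_set A ->
  gamma [set s *: x | x in A] <= s ^+ n * gamma A -> gamma A = 0.
Proof.
case: n A => // n A _ s01 mA; have /andP[s0 s1] := s01.
rewrite (_ : [set s *: x | x in A] = [set z | A (s^-1 *: z)]); last first.
  apply/seteqP; split=> [_ [x Ax <-]|z Az] /=; first by rewrite scalerK// gt_eqF.
  by exists (s^-1 *: z) => //; rewrite scalerA divff ?gt_eqF// scale1r.
rewrite -lee_fin EFinM !gamma_borel//; last exact: borel_scale.
move=> /(gauss_borel_dilation_eq s01 mA) H; apply: EFin_inj.
by rewrite gamma_borel.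
Qed.

(** * Young's inequality, the coefficients of the L_p sum, separation *)

Section young.
Variable R : realType.
Implicit Types u v c x : R.

Lemma ln_leB1 x : 0 < x -> ln x <= x - 1.
Proof. by move=> x0; have := @le_ln1Dx R (x - 1); rewrite [1 + _]addrC subrK; apply; lra. Qed.

Lemma ln_ltB1 x : 0 < x -> x != 1 -> ln x < x - 1.
Proof.
move=> x0 x1; have := @expR_gt1Dx R (ln x).
rewrite lnK ?posrE// ln_eq0// => /(_ x1); lra.
Qed.

Lemma weighted_ln u v c : 0 < u -> 0 < v -> 0 < c < 1 ->
  u `^ c * v `^ (1 - c) = expR (c * ln u + (1 - c) * ln v).
Proof. by move=> u0 v0 c01; rewrite /powR !gt_eqF// -expRD. Qed.

(** Concavity of [ln] through its tangent at the weighted mean [w]: the bounds [ln x <= x - 1] at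
    [u / w] and [v / w] average to 0. *)
Lemma young u v c : 0 < u -> 0 < v -> 0 < c < 1 ->
  u `^ c * v `^ (1 - c) <= c * u + (1 - c) * v.
Proof.
move=> u0 v0 /[dup] c01 /andP[c0 c1].
set w := c * u + (1 - c) * v; have w0 : 0 < w by rewrite addr_gt0// mulr_gt0// subr_gt0.
rewrite weighted_ln// -[leRHS](lnK w0) ler_expR.
have := ln_leB1 (divr_gt0 u0 w0); have := ln_leB1 (divr_gt0 v0 w0).
rewrite !ln_div ?posrE// => hv hu.
have E : c * (u / w - 1) + (1 - c) * (v / w - 1) = 0.
  by rewrite /w; field; rewrite -/w gt_eqF.
have : c * (ln u - ln w) <= c * (u / w - 1) by rewrite ler_pM2l.
have : (1 - c) * (ln v - ln w) <= (1 - c) * (v / w - 1) by rewrite ler_pM2l// subr_gt0.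
lra.
Qed.

Lemma young_lt u v c : 0 < u -> 0 < v -> 0 < c < 1 -> u != v ->
  u `^ c * v `^ (1 - c) < c * u + (1 - c) * v.
Proof.
move=> u0 v0 /[dup] c01 /andP[c0 c1] uv.
set w := c * u + (1 - c) * v; have w0 : 0 < w by rewrite addr_gt0// mulr_gt0// subr_gt0.
rewrite weighted_ln// -[ltRHS](lnK w0) ltr_expR.
have uw : u / w != 1.
  apply: contra_neq uv => uw.
  have uE : u = w by rewrite -[RHS]mul1r -uw divfK// gt_eqF.
  have c1' : 1 - c != 0 by rewrite gt_eqF// subr_gt0.
  by apply: (mulfI c1'); move: uE; rewrite /w; lra.
have := ln_ltB1 (divr_gt0 u0 w0) uw; have := ln_leB1 (divr_gt0 v0 w0).
rewrite !ln_div ?posrE// => hv hu.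
have E : c * (u / w - 1) + (1 - c) * (v / w - 1) = 0.
  by rewrite /w; field; rewrite -/w gt_eqF.
have : c * (ln u - ln w) < c * (u / w - 1) by rewrite ltr_pM2l.
have : (1 - c) * (ln v - ln w) <= (1 - c) * (v / w - 1) by rewrite ler_pM2l// subr_gt0.
lra.
Qed.

End young.

Section coefficients.
Variable R : realType.

Definition pcoef (p l mu : R) := mu `^ (1 - p^-1) * l `^ (p^-1).

Lemma psum_pscaleE n (p l : R) (K L : set 'rV[R]_n) :
  psum p (pscale p (1 - l) K) (pscale p l L) =
  [set z | exists x, exists y, exists mu : R, [/\ K x, L y, 0 <= mu <= 1 &
     z = pcoef p (1 - l) (1 - mu) *: x + pcoef p l mu *: y]].
Proof.
apply/seteqP; split=> z /=.
  move=> [_ [_ [mu [[x Kx <-] [y Ly <-] mu01 ->]]]].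
  by exists x, y, mu; split=> //; rewrite !scalerA.
move=> [x [y [mu [Kx Ly mu01 ->]]]].
exists ((1 - l) `^ (p^-1) *: x), (l `^ (p^-1) *: y), mu.
by split=> //; [exists x|exists y|rewrite !scalerA].
Qed.

Variable p : R.
Hypothesis p1 : 1 < p.

Let p0 : 0 < p. Proof. exact: lt_trans p1. Qed.

Lemma conj_exp01 : 0 < 1 - p^-1 < 1.
Proof. by rewrite subr_gt0 invf_lt1// p1 ltrBlDr ltrDl invr_gt0. Qed.

Lemma pcoef_ge0 (l mu : R) : 0 <= pcoef p l mu.
Proof. by rewrite mulr_ge0 ?powR_ge0. Qed.

Lemma pcoef_gt0 (l mu : R) : 0 < l -> 0 < mu -> 0 < pcoef p l mu.
Proof. by move=> l0 m0; rewrite mulr_gt0 ?powR_gt0. Qed.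

Lemma pcoefl0 (l : R) : pcoef p l 0 = 0.
Proof.
(* The exponent must be nonzero, since 0 to the power 0 is 1. *)
by rewrite /pcoef powR0 ?mul0r//; have /andP[/lt0r_neq0] := conj_exp01.
Qed.

Lemma pcoef1_lt1 (l : R) : 0 < l < 1 -> pcoef p l 1 < 1.
Proof.
move=> /andP[l0 l1]; rewrite /pcoef powR1 mul1r.
rewrite /powR gt_eqF// -[ltRHS]expR0 ltr_expR pmulr_rlt0 ?invr_gt0//.
by apply: ln_lt0; rewrite l0.
Qed.

Lemma pcoef_id (l : R) : 0 < l -> pcoef p l l = l.
Proof.
move=> l0; rewrite /pcoef -powRD; last by rewrite (gt_eqF l0) implybT.
by rewrite subrK powRr1// ltW.
Qed.

(** Young's inequality for the pairs [mu], [l] and [1 - mu], [1 - l]: the two right-hand sides add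
    up to 1. The endpoints in [mu] are separate because [young] takes positive arguments. *)
Lemma pcoefD_le1 (l mu : R) : 0 < l < 1 -> 0 <= mu <= 1 ->
  pcoef p (1 - l) (1 - mu) + pcoef p l mu <= 1.
Proof.
move=> /andP[l0 l1] /andP[m0 m1]; have c01 := conj_exp01; have /andP[c0 c1] := c01.
have l1' : 0 < 1 - l < 1 by rewrite subr_gt0 l1 ltrBlDr ltrDl.
have l01 : 0 < l < 1 by rewrite l0.
have [->|mn0] := eqVneq mu 0.
  by rewrite pcoefl0 subr0 addr0 ltW// pcoef1_lt1.
have [->|mn1] := eqVneq mu 1.
  by rewrite subrr pcoefl0 add0r ltW// pcoef1_lt1.
have m0' : 0 < mu by rewrite lt_neqAle eq_sym mn0.
have m1' : 0 < 1 - mu by rewrite subr_gt0 lt_neqAle mn1.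
have cE : p^-1 = 1 - (1 - p^-1) by ring.
have := young m0' l0 c01; have := young m1' (_ : 0 < 1 - l) c01.
rewrite subr_gt0 l1 => /(_ isT); rewrite -!cE /pcoef; lra.
Qed.

Lemma pcoefD_lt1 (l mu : R) : 0 < l < 1 -> 0 < mu < 1 -> mu != l ->
  pcoef p (1 - l) (1 - mu) + pcoef p l mu < 1.
Proof.
move=> /andP[l0 l1] /andP[m0 m1] ml; have c01 := conj_exp01.
have cE : p^-1 = 1 - (1 - p^-1) by ring.
have := young_lt m0 l0 c01 ml; have := @young R (1 - mu) (1 - l) _ _ _ c01.
rewrite !subr_gt0 l1 m1 => /(_ isT isT); rewrite -!cE /pcoef; lra.
Qed.

(* The equality case of Hölder's inequality: this [mu] is where the supremum over
   the fibres of the L_p sum is attained. *)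
Lemma pcoef_optimal (l A B : R) : 0 < l < 1 -> 0 < A -> 0 < B ->
  exists mu, 0 < mu < 1 /\
    pcoef p (1 - l) (1 - mu) * A + pcoef p l mu * B =
    ((1 - l) * A `^ p + l * B `^ p) `^ p^-1.
Proof.
move=> /andP[l0 l1] A0 B0.
set X := (1 - l) * _; set Y := l * _; set D := X + Y.
have X0 : 0 < X by rewrite mulr_gt0 ?powR_gt0 ?subr_gt0.
have Y0 : 0 < Y by rewrite mulr_gt0 ?powR_gt0.
have D0 : 0 < D by rewrite addr_gt0.
(* Equality in Hölder requires [mu] and [1 - mu] in the ratio of [Y] to [X]. *)
exists (Y / D); split.
  by rewrite divr_gt0// ltr_pdivrMr// mul1r ltrDr.
have -> : 1 - Y / D = X / D by rewrite /D; field; rewrite gt_eqF.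
(* The left side is (Z/D)^(1/q) Z^(1/p). Adding the cases [X] and [Y] leaves D^(1/p), as X + Y =
   D. *)
have aux (m Z C : R) : 0 < m -> 0 < C -> Z = m * C `^ p -> 0 < Z ->
    pcoef p m (Z / D) * C = Z / D * D `^ p^-1.
  move=> m0 C0 ZE Z0; rewrite /pcoef -mulrA.
  have -> : m `^ p^-1 * C = Z `^ p^-1.
    rewrite ZE powRM ?powR_ge0 ?ltW// -powRrM mulfV ?gt_eqF// powRr1// ltW//.
  have -> : Z `^ p^-1 = (Z / D) `^ p^-1 * D `^ p^-1.
    by rewrite -powRM ?divfK ?gt_eqF// ltW// divr_gt0.
  rewrite mulrA -powRD; last by rewrite (gt_eqF (divr_gt0 Z0 D0)) implybT.
  by rewrite subrK powRr1// ltW// divr_gt0.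
rewrite (aux _ X)// ?(aux _ Y)// ?subr_gt0//.
by rewrite -mulrDl -mulrDl divff ?mul1r// gt_eqF.
Qed.

End coefficients.

Section separation.
Variables (R : realType) (n : nat).
Implicit Types x y z u : 'rV[R]_n.

Definition dot u x : R := \sum_i u ord0 i * x ord0 i.

Lemma dotDr u x y : dot u (x + y) = dot u x + dot u y.
Proof. by rewrite /dot -big_split; apply: eq_bigr => i _; rewrite mxE mulrDr. Qed.

Lemma dotZr u c x : dot u (c *: x) = c * dot u x.
Proof. by rewrite /dot mulr_sumr; apply: eq_bigr => i _; rewrite mxE mulrCA. Qed.

Lemma dotC u x : dot u x = dot x u.
Proof. by apply: eq_bigr => i _; rewrite mulrC. Qed.

Lemma dotBr u x y : dot u (x - y) = dot u x - dot u y.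
Proof. by rewrite -scaleN1r dotDr dotZr mulN1r. Qed.

Lemma dot_ge0 x : 0 <= dot x x.
Proof. by apply: sumr_ge0 => i _; rewrite -expr2 sqr_ge0. Qed.

Lemma dot_eq0 x : dot x x = 0 -> x = 0.
Proof.
move=> /eqP; rewrite psumr_eq0 => [/allP H|i _]; last by rewrite -expr2 sqr_ge0.
apply/rowP => i; rewrite mxE; have := H i (mem_index_enum i).
by rewrite -expr2 sqrf_eq0 => /eqP.
Qed.

Lemma continuous_dot u : continuous (dot u).
Proof.
apply: continuous_big => [|i _ x]; first exact: add_continuous.
by apply: continuousM; [exact: cst_continuous|exact: coord_continuous].
Qed.

Lemma continuous_sqdist x : continuous (fun z : 'rV[R]_n => dot (z - x) (z - x)).
Proof.
apply: continuous_big => [|i _ z]; first exact: add_continuous.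
have H : {for z, continuous (fun z' : 'rV[R]_n => (z' - x) ord0 i)}.
  apply: (@continuous_comp _ _ _ (fun z' : 'rV[R]_n => z' - x) (fun w => w ord0 i)).
    apply: (@continuousB _ _ _ id (cst x)); last exact: cst_continuous.
    by move=> ?; exact.
  exact: coord_continuous.
exact: (continuousM H H).
Qed.

Lemma convex_body_conv (C : set 'rV[R]_n) x y (t : R) : convex_body C ->
  C x -> C y -> 0 <= t <= 1 -> C (t *: x + (1 - t) *: y).
Proof.
move=> [_ _ cC] Cx Cy /andP[t0 t1].
have := cC x y (Itv01 t0 t1) (mem_set Cx) (mem_set Cy).
by rewrite inE.
Qed.

(* [u = x - y] where [y] is the point of [C] nearest to [x]. *)
Lemma separation (C : set 'rV[R]_n) x : convex_body C -> ~ C x ->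
  exists u, forall z, C z -> dot u z < dot u x.
Proof.
move=> cC nCx; have [C0 kC _] := cC.
have [|y] := EVT_min_rV C0 kC (f := fun z => dot (z - x) (z - x)).
  exact/continuous_subspaceT/continuous_sqdist.
rewrite inE => Cy ymin; exists (x - y) => z Cz.
have xy : 0 < dot (x - y) (x - y).
  rewrite lt_neqAle dot_ge0 andbT eq_sym; apply/eqP => /dot_eq0 /eqP.
  by rewrite subr_eq0 => /eqP xy; apply: nCx; rewrite xy.
suff : dot (x - y) (z - y) <= 0 by move: xy; rewrite !dotBr; lra.
rewrite leNgt; apply/negP => d0.
set d := dot (x - y) (z - y) in d0; set W := dot (z - y) (z - y).
have W0 : 0 <= W by exact: dot_ge0.
have dW : 0 < d + W + 1 by lra.
(* Moving from [y] towards [z] by [e] changes the squared distance to [x] by e^2 W - 2 e d. This [e]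
   is at most 1 and has e W < d, so the distance drops below its minimum. *)
pose e := d / (d + W + 1).
have e0 : 0 < e by rewrite divr_gt0.
have e1 : e <= 1 by rewrite ler_pdivrMr//; lra.
have /ymin : e *: z + (1 - e) *: y \in C.
  by rewrite inE; apply: convex_body_conv => //; rewrite e1 ltW.
have -> : e *: z + (1 - e) *: y - x = e *: (z - y) - (x - y).
  by apply/rowP => i; rewrite !mxE; ring.
have -> : y - x = - 1 *: (x - y) by rewrite scaleN1r opprB.
rewrite dotBr !dotZr ![dot _ (z - y)]dotC ![dot _ (x - y)]dotC !(dotBr, dotZr).
rewrite -!dotBr -/W [dot (z - y) (x - y)]dotC -/d => H.
have : e * W < d.
  by rewrite /e mulrAC ltr_pdivrMr// ltr_pM2l//; lra.
nra.
Qed.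

End separation.

(** * Support functions and full-measure subsets *)

Section support.
Variables (R : realType) (n : nat) (p l : R).
Hypotheses (p1 : 1 < p) (l01 : 0 < l < 1).

Lemma is_derive_pcoef (m x : R) : 0 < x ->
  is_derive x 1 (pcoef p m) ((1 - p^-1) * x `^ (- p^-1) * m `^ p^-1).
Proof.
move=> x0; have := is_derive1_powR (1 - p^-1) x0.
rewrite addrAC subrr add0r => dx.
rewrite (_ : pcoef p m = (fun x => m `^ p^-1 *: (x `^ (1 - p^-1) : R^o))).
  by apply: is_derive_eq; rewrite [LHS]mulrC.
by apply/funext => y; rewrite /pcoef mulrC.
Qed.

Lemma is_derive_pcoef_onem (m x : R) : 0 < 1 - x ->
  is_derive x 1 (fun x => pcoef p m (1 - x))
    (- ((1 - p^-1) * (1 - x) `^ (- p^-1) * m `^ p^-1)).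
Proof.
move=> x0; have := is_derive_pcoef m x0 => dx.
have d1 : is_derive x 1 (fun x : R => 1 - x) (-1).
  rewrite (_ : (fun x => _) = (cst 1 : R -> R) - id)//.
  by apply: is_derive_eq; rewrite sub0r.
by apply: is_derive_eq; rewrite mulrN1.
Qed.

(* First-order condition at the interior maximum [mu = l]. *)
Lemma pcoef_max_eq (k h : R) :
  (forall mu, 0 <= mu <= 1 ->
    pcoef p (1 - l) (1 - mu) * k + pcoef p l mu * h <= (1 - l) * k + l * h) ->
  k = h.
Proof.
move=> H; have /andP[l0 l1] := l01.
pose f (mu : R) := pcoef p (1 - l) (1 - mu) * k + pcoef p l mu * h.
have df (x : R) : 0 < x < 1 -> is_derive x 1 f
    (- ((1 - p^-1) * (1 - x) `^ (- p^-1) * (1 - l) `^ p^-1) * k +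
     (1 - p^-1) * x `^ (- p^-1) * l `^ p^-1 * h).
  move=> /andP[x0 x1]; have x1' : 0 < 1 - x by rewrite subr_gt0.
  have d1 := is_derive_pcoef_onem (1 - l) x1'.
  have d2 := is_derive_pcoef l x0.
  rewrite (_ : f = (fun x => k *: (pcoef p (1 - l) (1 - x) : R^o)
     + h *: (pcoef p l x : R^o))); last first.
    by apply/funext => y; rewrite /f mulrC [_ * h]mulrC.
  by apply: is_derive_eq; rewrite ![_ *: _]mulrC.
have d0 : is_derive l 1 f 0.
  apply: (@derive1_at_max _ f 0 1) => //.
  - by move=> t; rewrite in_itv/= => t01; have [] := df t t01.
  - move=> t; rewrite in_itv/= => /andP[t0 t1].
    rewrite {2}/f !pcoef_id ?subr_gt0//; apply: H.
    by rewrite !ltW.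
have [_ e0] := d0; have [_] := df l l01; rewrite e0.
(* At [mu = l] the powers cancel, so the derivative is (1 - 1/p) (h - k). *)
have pw (x : R) : 0 < x -> x `^ (- p^-1) * x `^ p^-1 = 1.
  by move=> x0; rewrite powRN mulVf// gt_eqF// powR_gt0.
rewrite -!(mulrA (1 - p^-1)) !pw ?subr_gt0// !mulr1.
have /andP[c0 _] := conj_exp01 p1.
move=> E; apply/esym/eqP; rewrite -subr_eq0 -(mulrI_eq0 _ (mulfI (lt0r_neq0 c0))).
by apply/eqP; rewrite E; ring.
Qed.

Variables (K L : set 'rV[R]_n).
Hypotheses (cK : convex_body K) (cL : convex_body L).
Hypothesis sub : psum p (pscale p (1 - l) K) (pscale p l L) `<=` mink (1 - l) K l L.

(** [k] and [h] are the support functions of [K] and [L] at [u], attained by compactness. *)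
Lemma support_le (u : 'rV[R]_n) : exists k h : R,
  [/\ exists2 x, K x & dot u x = k, exists2 y, L y & dot u y = h,
      forall x, K x -> dot u x <= k, forall y, L y -> dot u y <= h & k = h /\ 0 <= k].
Proof.
have [K0 kK _] := cK; have [L0 kL _] := cL; have /andP[l0 l1] := l01.
have [|x0] := EVT_max_rV K0 kK (f := dot u).
  exact/continuous_subspaceT/continuous_dot.
rewrite inE => Kx0 x0max.
have [|y0] := EVT_max_rV L0 kL (f := dot u).
  exact/continuous_subspaceT/continuous_dot.
rewrite inE => Ly0 y0max.
have H mu : 0 <= mu <= 1 ->
    pcoef p (1 - l) (1 - mu) * dot u x0 + pcoef p l mu * dot u y0 <=
    (1 - l) * dot u x0 + l * dot u y0.
  (* The fibre point built from the two maximisers lies in the Minkowski combination, where [dot u]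
     is at most the right-hand side. *)
  move=> mu01; rewrite -!dotZr -dotDr.
  have /sub [x Kx [y Ly <-]] : psum p (pscale p (1 - l) K) (pscale p l L)
      (pcoef p (1 - l) (1 - mu) *: x0 + pcoef p l mu *: y0).
    by rewrite psum_pscaleE; exists x0, y0, mu.
  rewrite dotDr !dotZr lerD// ler_pM2l ?subr_gt0//.
    by apply: x0max; rewrite inE.
  by apply: y0max; rewrite inE.
have kh := pcoef_max_eq H.
exists (dot u x0), (dot u y0); split; [by exists x0|by exists y0| | |].
- by move=> x Kx; apply: x0max; rewrite inE.
- by move=> y Ly; apply: y0max; rewrite inE.
(* At [mu = 0] the bound reads c k <= k with c < 1, whence k >= 0. *)
split=> //; have := H 0; rewrite lexx ler01 => /(_ isT).
rewrite subr0 pcoefl0// mul0r addr0 -kh -mulrDl subrK mul1r.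
have : pcoef p (1 - l) 1 < 1 by apply: pcoef1_lt1 => //; rewrite subr_gt0 l1 ltrBlDr ltrDl.
nra.
Qed.

(** By separation, convex bodies with equal support functions coincide, and one with a nonnegative
    support function contains the origin. *)
Lemma psum_sub_mink_eq : K = L /\ (K `&` L) 0.
Proof.
have KL : K = L.
  apply/seteqP; split=> z Az; apply: contrapT => nz.
    have [u uz] := separation cL nz.
    have [k [h [_ [y Ly yh] kmax _ [kh _]]]] := support_le u.
    by have := uz _ Ly; rewrite yh -kh ltNge kmax.
  have [u uz] := separation cK nz.
  have [k [h [[x Kx xk] _ _ hmax [kh _]]]] := support_le u.
  by have := uz _ Kx; rewrite xk kh ltNge hmax.
split=> //; rewrite -KL setIid; apply: contrapT => n0.
have [u u0] := separation cK n0.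
have [k [h [[x Kx xk] _ _ _ [_ k0]]]] := support_le u.
have := u0 _ Kx; rewrite xk (_ : dot u 0 = 0) ?ltNge ?k0//.
by rewrite -(scale0r u) dotZr mul0r.
Qed.

End support.

Section measure_part.
Variables (R : realType) (n : nat).
Implicit Types K L M S : set 'rV[R]_n.

Lemma compact_borel K : compact K -> borel_set K.
Proof.
by move=> kK; apply: closed_borel; apply: compact_closed kK; exact: norm_hausdorff.
Qed.

Lemma compact_mink a b K L : compact K -> compact L -> compact (mink a K b L).
Proof.
move=> kK kL.
have -> : mink a K b L = (fun z : 'rV[R]_n * 'rV[R]_n => a *: z.1 + b *: z.2) @` (K `*` L).
  apply/seteqP; split=> [_ [x Kx [y Ly <-]]|_ [[x y] [/= Kx Ly] <-]].
    by exists (x, y).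
  by exists x => //; exists y.
apply: continuous_compact; last exact: compact_setX.
apply: continuous_subspaceT => z.
apply: (@continuousD _ _ _ (fun z : 'rV[R]_n * 'rV[R]_n => a *: z.1) (fun z => b *: z.2)).
  apply: (@continuous_comp _ _ _ fst (fun w => a *: w)); first exact: cvg_fst.
  exact: scaler_continuous.
apply: (@continuous_comp _ _ _ snd (fun w => b *: w)); first exact: cvg_snd.
exact: scaler_continuous.
Qed.

(** Together with [homothety_inv], this inverts the homothety of ratio [c] that sends [x0] to
    [z]. *)
Lemma homothety_K (c : R) (w x0 z : 'rV[R]_n) : c != 0 ->
  z + c *: (c^-1 *: w + (x0 - c^-1 *: z) - x0) = w.
Proof. by move=> c0; apply/rowP => i; rewrite !mxE; field. Qed.

Lemma homothety_inv (c : R) (w x0 z : 'rV[R]_n) : c != 0 ->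
  c^-1 *: (c *: w + (z - c *: x0)) + (x0 - c^-1 *: z) = w.
Proof. by move=> c0; apply/rowP => i; rewrite !mxE; field. Qed.

(* If [z] were outside the closed set [M], then a small homothetic copy of [K]
   near [z] would lie in [S `\` M], hence be null. *)
Lemma closed_full_mem S M K (z x0 : 'rV[R]_n) (a : R) :
  compact K -> 0 < gamma K -> compact M -> M `<=` S -> gamma S <= gamma M ->
  0 < a -> (forall e x, 0 < e < 1 -> K x -> S (z + (e * a) *: (x - x0))) -> M z.
Proof.
move=> kK K0 kM MS SM a0 H; apply: contrapT => nMz.
have cM : closed M by apply: compact_closed kM; exact: norm_hausdorff.
have /nbhs_ballP[d /= d0 dM] : nbhs z (~` M).
  by apply: open_nbhs_nbhs; split=> //; exact: closed_openC.
have [C [C0 HC]] : exists C : R, 0 < C /\ forall x, K x -> `|x - x0| <= C.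
  have [N [Nr HN]] := compact_bounded kK.
  exists (`|N| + 1 + `|x0|); split; first by rewrite ltr_wpDr// ltr_wpDl.
  move=> x Kx; rewrite (le_trans (ler_normB _ _))// lerD2r.
  by apply: HN => //; rewrite ltr_pwDr// ler_norm.
(* The copy of [K] of ratio [e * a] stays within e a C < d of [z], inside the ball that misses
   [M]. *)
pose e := Num.min (2^-1) (d / (a * C) / 2).
have aC0 : 0 < a * C by rewrite mulr_gt0.
have e0 : 0 < e by rewrite lt_min invr_gt0 ltr0n/= !divr_gt0.
have e1 : e < 1 by rewrite gt_min; apply/orP; left; lra.
have ed : e * a * C < d.
  rewrite -mulrA -ltr_pdivlMr//; apply: (@le_lt_trans _ _ (d / (a * C) / 2)).
    by rewrite ge_min lexx orbT.
  by rewrite ltr_pdivrMr// ltr_pMr ?divr_gt0// ltr1n.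
have ea0 : 0 < e * a by rewrite mulr_gt0.
(* The homothetic copy, written as a preimage so that it is visibly Borel. *)
pose T := [set w | K ((e * a)^-1 *: w + (x0 - (e * a)^-1 *: z))].
have TE w : T w -> exists2 x, K x & w = z + (e * a) *: (x - x0).
  move=> Tw; exists ((e * a)^-1 *: w + (x0 - (e * a)^-1 *: z)) => //.
  by rewrite homothety_K// gt_eqF.
have mT : borel_set T by apply: borel_affine; exact: compact_borel.
have mM := compact_borel kM.
have mU : borel_set (M `|` T) by exact: (@measurableU _ (borelT R n)).
have TM : T `<=` ~` M.
  move=> w /TE[x Kx ->]; apply: dM; rewrite -ball_normE /=.
  rewrite opprD addNKr normrN normrZ gtr0_norm//.
  by apply: le_lt_trans ed; rewrite ler_pM2l// HC.
have T0 : gauss_borel T = 0%E.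
  have -> : T = (M `|` T) `\` M.
    by apply/seteqP; split=> w; [move=> Tw; split; [right|exact: TM]|case=> -[]].
  apply: gamma_setD_eq0 => //.
  apply/eqP; rewrite eq_le le_gamma//=; apply: le_trans SM; apply: le_gamma.
  move=> w [/MS//|/TE[x Kx ->]]; apply: H => //.
  by rewrite e0.
(* [K] is in turn an affine preimage of the null set [T], against [0 < gamma K]. *)
have := gauss_borel_affine_null (z - (e * a) *: x0) ea0 mT T0.
rewrite (_ : [set w | _] = K); last first.
  by apply/seteqP; split=> w; rewrite /T /mkset homothety_inv// gt_eqF.
rewrite -gamma_borel; last exact: compact_borel.
by case=> K00; move: K0; rewrite K00 ltxx.
Qed.

End measure_part.

(** * The L_p inequality and its equality case *)

Section final.
Variables (R : realType) (n : nat) (K L : set 'rV[R]_n).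
Hypotheses (n0 : (0 < n)%N) (adm : admissible K L).
Local Notation ninv := (n%:R^-1 : R).
Local Notation S p l := (psum p (pscale p (1 - l) K) (pscale p l L)).
Local Notation D p l :=
  ((1 - l) * gamma K `^ (p / n%:R) + l * gamma L `^ (p / n%:R)).

Lemma admissible_gamma_gt0 : 0 < gamma K /\ 0 < gamma L.
Proof.
have [_ _ H _ _] := adm; have := gamma_ge0 K; have := gamma_ge0 L.
rewrite !le_eqVlt => /predU1P[L0|->]; first by rewrite -L0 mulr0 ltxx in H.
by move=> /predU1P[K0|->//]; rewrite -K0 mul0r ltxx in H.
Qed.

Let ninv0 : 0 < ninv. Proof. by rewrite invr_gt0 ltr0n. Qed.

Lemma powR_invnK (x : R) : 0 <= x -> (x ^+ n) `^ ninv = x.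
Proof.
by move=> x0; rewrite -powR_mulrn// -powRrM divff ?powRr1// pnatr_eq0 -lt0n.
Qed.

(** The optimal fibre in the form s ((1-t) K + t L), with all that the inequality and its equality
    case use of it. *)
Lemma psum_inner p l : 1 < p -> 0 < l < 1 -> exists s t : R,
  [/\ 0 < s <= 1, 0 < t < 1,
      [set s *: x | x in mink (1 - t) K t L] `<=` S p l,
      D p l `^ p^-1 <= s * gamma (mink (1 - t) K t L) `^ ninv &
      s = 1 -> t = l].
Proof.
move=> p1 l01; have /andP[l0 l1] := l01; have [K0 L0] := admissible_gamma_gt0.
(* Hölder is applied to the numbers gamma(K)^(1/n) and gamma(L)^(1/n). *)
have [mu [mu01 E]] := pcoef_optimal p1 l01 (powR_gt0 ninv K0) (powR_gt0 ninv L0).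
have /andP[m0 m1] := mu01.
set a := pcoef p (1 - l) (1 - mu) in E; set b := pcoef p l mu in E.
have a0 : 0 < a by apply: pcoef_gt0; rewrite subr_gt0.
have b0 : 0 < b by exact: pcoef_gt0.
have s0 : 0 < a + b by rewrite addr_gt0.
have s1 : a + b <= 1 by apply: pcoefD_le1; rewrite // !ltW.
have aE : a = (a + b) * (1 - b / (a + b)) by field; rewrite gt_eqF.
have bE : b = (a + b) * (b / (a + b)) by field; rewrite gt_eqF.
have t01 : 0 < b / (a + b) < 1.
  by rewrite divr_gt0//= ltr_pdivrMr// mul1r ltrDr.
exists (a + b), (b / (a + b)); split=> //.
- by rewrite s0.
- move=> _ [_ [x Kx [y Ly <-]] <-]; rewrite psum_pscaleE.
  exists x, y, mu; split=> //; first by rewrite !ltW.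
  by rewrite scalerDr !scalerA -aE -bE.
- have [_ _ _ _ /(_ _ t01) H] := adm.
  apply: (@le_trans _ _ ((a + b) * ((1 - b / (a + b)) * gamma K `^ ninv +
      b / (a + b) * gamma L `^ ninv))); last by rewrite ler_pM2l.
  rewrite mulrDr (mulrA _ (1 - _)) (mulrA _ (b / _)) -aE -bE E -!powRrM.
  by rewrite ![ninv * p]mulrC.
- move=> s_1; have [ml|ml] := eqVneq mu l; last first.
    by have := pcoefD_lt1 p1 l01 mu01 ml; rewrite -/a -/b s_1 ltxx.
  by rewrite s_1 divr1 /b ml pcoef_id.
Qed.

Lemma powR_D_gt0 p l : 0 < l < 1 -> 0 < D p l.
Proof.
move=> /andP[l0 l1]; have [K0 L0] := admissible_gamma_gt0.
by rewrite addr_gt0// mulr_gt0 ?powR_gt0 ?subr_gt0.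
Qed.

(** With M the Minkowski combination in the optimal fibre, s gamma(M)^(1/n) is the n-th root of s^n
    gamma(M), which is at most gamma(s M); then both sides are raised to the power [p]. *)
Lemma gamma_psum_ge p l : 1 < p -> 0 < l < 1 -> D p l <= gamma (S p l) `^ (p / n%:R).
Proof.
move=> p1 l01; have p0 : 0 < p by exact: lt_trans p1.
have [s [t [s01 t01 sub HD _]]] := psum_inner p1 l01.
have /andP[s0 _] := s01.
have D0 := powR_D_gt0 p l01.
have -> : D p l = (D p l `^ p^-1) `^ p.
  by rewrite -powRrM mulVf ?gt_eqF// powRr1// ltW.
have -> : gamma (S p l) `^ (p / n%:R) = (gamma (S p l) `^ ninv) `^ p.
  by rewrite -powRrM mulrC.
apply: ge0_ler_powR; rewrite ?nnegrE ?powR_ge0 ?(ltW p0)//.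
apply: le_trans HD _; rewrite -{1}(powR_invnK (ltW s0)) -powRM ?gamma_ge0 ?exprn_ge0 ?(ltW s0)//.
apply: ge0_ler_powR; rewrite ?nnegrE ?mulr_ge0 ?gamma_ge0 ?exprn_ge0 ?(ltW s0) ?(ltW ninv0)//.
apply: le_trans (gamma_dilation _ s01) _; exact: le_gamma.
Qed.

(* Equality forces [s = 1], i.e. the optimal fibre of the L_p sum is the Minkowski
   combination itself, and that this fibre has full measure in the L_p sum. *)
Lemma gamma_psum_eq p l : 1 < p -> 0 < l < 1 -> compact K -> compact L ->
  gamma (S p l) `^ (p / n%:R) = D p l ->
  mink (1 - l) K l L `<=` S p l /\ gamma (S p l) <= gamma (mink (1 - l) K l L).
Proof.
move=> p1 l01 kK kL E; have p0 : 0 < p by exact: lt_trans p1.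
have [s [t [s01 t01 sub HD st]]] := psum_inner p1 l01.
have /andP[s0 s1] := s01; have D0 := powR_D_gt0 p l01.
set M := mink (1 - t) K t L in sub HD.
have SE : gamma (S p l) `^ ninv = D p l `^ p^-1.
  by rewrite -E -powRrM mulrAC divff ?gt_eqF// mul1r.
(* Equality turns the bound on the optimal fibre into the reverse of the dilation inequality. *)
have SM : gamma (S p l) <= s ^+ n * gamma M.
  have : gamma (S p l) `^ ninv <= (s ^+ n * gamma M) `^ ninv.
    by rewrite SE powRM ?gamma_ge0 ?exprn_ge0 ?(ltW s0)// powR_invnK// ltW.
  rewrite !leNgt; apply: contra => lt; apply: gt0_ltr_powR => //;
  by rewrite nnegrE ?gamma_ge0// mulr_ge0 ?gamma_ge0// exprn_ge0// ltW.
have [s_1|sn1] := eqVneq s 1.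
  have tl := st s_1; move: sub SM; rewrite /M tl s_1 expr1n mul1r => sub SM; split=> //.
  by move=> z Mz; apply: sub; exists z => //; rewrite scale1r.
have s01' : 0 < s < 1 by rewrite s0 lt_neqAle sn1.
have mM : borel_set M by apply: compact_borel; exact: compact_mink.
(* For s < 1 the strict dilation inequality would make [M] null, although [HD] bounds it below by a
   positive number. *)
have M0 : gamma M = 0.
  apply: (gamma_dilation_eq n0 s01' mM); apply: le_trans SM; exact: le_gamma.
move: HD; rewrite M0 powR0 ?gt_eqF// mulr0 leNgt powR_gt0//.
Qed.

(** With [mu] and [y0] fixed, replacing [x0] by e x + (1-e) x0 stays in the L_p sum by convexity and
    moves [z] by e a (x - x0), which is the copy of [K] asked for by [closed_full_mem]. This needs a
    > 0, true at [mu = 0]; for [mu != 0] the copy of [L] is used, as b > 0. *)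
Lemma psum_sub_mink p l : 1 < p -> 0 < l < 1 -> convex_body K -> convex_body L ->
  mink (1 - l) K l L `<=` S p l -> gamma (S p l) <= gamma (mink (1 - l) K l L) ->
  S p l `<=` mink (1 - l) K l L.
Proof.
move=> p1 l01 cK cL MS SM z Sz.
have /andP[l0 l1] := l01; have [K0 L0] := admissible_gamma_gt0.
have [_ kK _] := cK; have [_ kL _] := cL.
have kM : compact (mink (1 - l) K l L) by exact: compact_mink.
move: (Sz); rewrite psum_pscaleE => -[x0 [y0 [mu [Kx0 Ly0 mu01 zE]]]].
have /andP[m0 m1] := mu01.
have [mu0|mun0] := eqVneq mu 0.
  have a0 : 0 < pcoef p (1 - l) (1 - mu) by rewrite mu0 subr0 pcoef_gt0// subr_gt0.
  apply: (closed_full_mem (x0 := x0) kK K0 kM MS SM a0) => e x /andP[e0 e1] Kx.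
  rewrite psum_pscaleE; exists (e *: x + (1 - e) *: x0), y0, mu; split=> //.
    by apply: convex_body_conv => //; rewrite !ltW.
  by rewrite zE; apply/rowP => i; rewrite !mxE; ring.
have b0 : 0 < pcoef p l mu by rewrite pcoef_gt0// lt_neqAle eq_sym mun0.
apply: (closed_full_mem (x0 := y0) kL L0 kM MS SM b0) => e y /andP[e0 e1] Ly.
rewrite psum_pscaleE; exists x0, (e *: y + (1 - e) *: y0), mu; split=> //.
  by apply: convex_body_conv => //; rewrite !ltW.
by rewrite zE; apply/rowP => i; rewrite !mxE; ring.
Qed.

End final.

(** Since a + b <= 1, the point a x + b y is a convex combination of a point of [K] and the origin;
    conversely [mu = l] with x = y = z gives back [z]. *)
Lemma psum_pscale_self (R : realType) n (p l : R) (K : set 'rV[R]_n) : 1 < p -> 0 < l < 1 ->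
  convex_body K -> K 0 -> psum p (pscale p (1 - l) K) (pscale p l K) = K.
Proof.
move=> p1 l01 cK K0; have /andP[l0 l1] := l01.
rewrite psum_pscaleE; apply/seteqP; split=> [z [x [y [mu [Kx Ky mu01 ->]]]]|z Kz].
  set a := pcoef _ _ _; set b := pcoef _ _ _.
  have a0 : 0 <= a by exact: pcoef_ge0.
  have b0 : 0 <= b by exact: pcoef_ge0.
  have ab1 : a + b <= 1 by exact: pcoefD_le1.
  have [ab0|abn0] := eqVneq (a + b) 0.
    have -> : a = 0 by lra.
    have -> : b = 0 by lra.
    by rewrite !scale0r addr0.
  have -> : a *: x + b *: y = (a + b) *: ((a / (a + b)) *: x + (1 - a / (a + b)) *: y)
      + (1 - (a + b)) *: 0.
    by apply/rowP => i; rewrite !mxE; field.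
  have ab_gt0 : 0 < a + b by rewrite lt_neqAle eq_sym abn0 addr_ge0.
  apply: convex_body_conv => //; last by rewrite ab1 ltW.
  apply: convex_body_conv => //; rewrite divr_ge0 ?(ltW ab_gt0)//=.
  by rewrite ler_pdivrMr// mul1r lerDl.
exists z, z, l; split=> //; first by rewrite !ltW.
by rewrite !pcoef_id ?subr_gt0// -scalerDl subrK scale1r.
Qed.

Unset Implicit Arguments.

Theorem mainTheorem7 (R : realType) (n : nat) (K L : set 'rV[R]_n) :
  (0 < n)%N -> admissible K L ->
  (forall (p l : R), 1 < p -> 0 < l < 1 ->
     gmeasurable (psum p (pscale p (1 - l) K) (pscale p l L)) ->
     gamma (psum p (pscale p (1 - l) K) (pscale p l L)) `^ (p / n%:R) >=
     (1 - l) * gamma K `^ (p / n%:R) + l * gamma L `^ (p / n%:R))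
  /\
  (convex_body K -> convex_body L ->
     ((exists (p l : R), [/\ 1 < p, 0 < l < 1,
         gmeasurable (psum p (pscale p (1 - l) K) (pscale p l L)) &
         gamma (psum p (pscale p (1 - l) K) (pscale p l L)) `^ (p / n%:R) =
         (1 - l) * gamma K `^ (p / n%:R) + l * gamma L `^ (p / n%:R)])
      <-> (K = L /\ (K `&` L) 0))).
Proof.
move=> n0 adm; split=> [p l p1 l01 _|cK cL]; first exact: gamma_psum_ge.
split=> [[p [l [p1 l01 _ E]]]|[KL [K0 _]]].
  have [_ kK _] := cK; have [_ kL _] := cL.
  have [MS SM] := gamma_psum_eq n0 adm p1 l01 kK kL E.
  by apply: (psum_sub_mink_eq p1 l01 cK cL); exact: psum_sub_mink.
(* The L_p sum is [K] itself, so both sides are gamma(K)^(p/n). *)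
rewrite -KL; exists 2, 2^-1.
have h2 : 0 < (2^-1 : R) < 1 by lra.
rewrite psum_pscale_self ?ltr1n//; split=> //; first by have [_ []] := adm.
by rewrite -mulrDl subrK mul1r.
Qed.
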